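(* Let $m,n\in\mathbb{Z}\setminus\{0\}$ and let $G=\mathrm{BS}(m,n)=\langle t,a\mid a^{n-m}[t,a^{m}]=1\rangle$. Then, for any $c\in\mathbb{N}$ with $c\geq 2$, $\mathrm{gr}_c(G)=\gamma_c(G)/\gamma_{c+1}(G)$ is a finite abelian group.
   Context: $[x,y]=x^{-1}y^{-1}xy$, so the given presentation is equivalent to the usual one, $\langle t,a\mid t^{-1}a^mt=a^n\rangle$. $\gamma_1(G)=G$ and $\gamma_{c}(G)=[\gamma_{c-1}(G),G]$ for $c\ge 2$ are the terms of the lower central series of $G$. *)

(* Defs.v *)
(* MathComp, with the classical layer of MathComp-Analysis for predicates that
   need not be decidable. *)
From HB Require Import structures.
From mathcomp Require Import ssreflect ssrfun ssrbool eqtype ssrnat seq choice.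
From mathcomp Require Import fintype monoid generic_quotient ssralg ssrint.
From mathcomp Require Import boolp classical_sets cardinality.

Set Implicit Arguments.
Unset Strict Implicit.
Unset Printing Implicit Defensive.

Local Open Scope group_scope.

Definition expgz (G : groupType) (x : G) (k : int) : G :=
  match k with Posz n => x ^+ n | Negz n => x ^- n.+1 end.

(* A subgroup of the possibly infinite group G is a [groupClosed G]. *)
HB.mixin Record isConjClosed (G : groupType) (S : {pred G}) := {
  conjg_closed : forall x y : G, x \in S -> x ^ y \in S
}.

#[short(type="normalSubgroup")]
HB.structure Definition NormalSubgroup (G : groupType) :=
  {S of isConjClosed G S & GroupClosed G S}.

Section SubgroupType.
Variables (G : groupType) (H : groupClosed G).

Definition subgroup_type := {x : G | x \in H}.

Lemma subgroup_type_closed : group_closed [pred x | x \in H].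
Proof. by split; [exact: gpred1 | exact: gpredF]. Qed.

HB.instance Definition _ := SubChoice.on subgroup_type.
HB.instance Definition _ :=
  SubChoice_isSubGroup.Build G _ subgroup_type subgroup_type_closed.
End SubgroupType.

Section GeneratedSubgroup.
Variables (G : groupType) (A : set G).

Definition generated : {pred G} :=
  [pred x | `[< forall H : groupClosed G, {subset A <= H} -> x \in H >]].

Lemma generated1 : 1 \in generated.
Proof. by apply/asboolP => H _; exact: gpred1. Qed.
Lemma generatedM : mulg_closed generated.
Proof.
by move=> x y /asboolP hx /asboolP hy; apply/asboolP => H sAH;
  apply: gpredM; [exact: hx | exact: hy].
Qed.
Lemma generatedV : invg_closed generated.
Proof.
by move=> x /asboolP hx; apply/asboolP => H sAH; rewrite gpredV; exact: hx.
Qed.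
HB.instance Definition _ := isMulClosed.Build G generated generatedM.
HB.instance Definition _ := isMul1Closed.Build G generated generated1.
HB.instance Definition _ := isInvClosed.Build G generated generatedV.

Definition normal_closure : {pred G} :=
  [pred x | `[< forall N : normalSubgroup G, {subset A <= N} -> x \in N >]].

Lemma normal_closure1 : 1 \in normal_closure.
Proof. by apply/asboolP => N _; exact: gpred1. Qed.
Lemma normal_closureM : mulg_closed normal_closure.
Proof.
by move=> x y /asboolP hx /asboolP hy; apply/asboolP => N sAN;
  apply: gpredM; [exact: hx | exact: hy].
Qed.
Lemma normal_closureV : invg_closed normal_closure.
Proof.
by move=> x /asboolP hx; apply/asboolP => N sAN; rewrite gpredV; exact: hx.
Qed.
Lemma normal_closureJ (x y : G) :
  x \in normal_closure -> x ^ y \in normal_closure.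
Proof.
by move=> /asboolP hx; apply/asboolP => N /hx; exact: conjg_closed.
Qed.
HB.instance Definition _ := isMulClosed.Build G normal_closure normal_closureM.
HB.instance Definition _ := isMul1Closed.Build G normal_closure normal_closure1.
HB.instance Definition _ := isInvClosed.Build G normal_closure normal_closureV.
HB.instance Definition _ := isConjClosed.Build G normal_closure normal_closureJ.
End GeneratedSubgroup.

Section QuotientGroup.
Variables (G : groupType) (N : normalSubgroup G).
Local Open Scope quotient_scope.

Definition coset_rel : rel G := fun x y => x^-1 * y \in N.

Lemma coset_rel_refl : reflexive coset_rel.
Proof. by move=> x; rewrite /coset_rel mulVg gpred1. Qed.
Lemma coset_rel_sym : symmetric coset_rel.
Proof. by move=> x y; rewrite /coset_rel -gpredV invgM invgK. Qed.
Lemma coset_rel_trans : transitive coset_rel.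
Proof.
move=> y x z; rewrite /coset_rel => xy yz.
by have := gpredM _ _ xy yz; rewrite mulgA -(mulgA x^-1) mulgV mulg1.
Qed.
Canonical coset_equiv :=
  EquivRel coset_rel coset_rel_refl coset_rel_sym coset_rel_trans.

Definition quotient_group := {eq_quot coset_rel}.
HB.instance Definition _ := Choice.on quotient_group.
HB.instance Definition _ := EqQuotient.on quotient_group.

Lemma coset_eqP (x y : G) :
  reflect (x = y %[mod quotient_group]) (x^-1 * y \in N).
Proof. exact: (eqquotP quotient_group x y). Qed.

Definition quotient_one : quotient_group := \pi 1.
Definition quotient_mul (u v : quotient_group) : quotient_group :=
  \pi (repr u * repr v).
Definition quotient_inv (u : quotient_group) : quotient_group :=
  \pi (repr u)^-1.

Lemma quotient_mulE (x y : G) :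
  quotient_mul (\pi x) (\pi y) = \pi (x * y).
Proof.
rewrite /quotient_mul; case: piP => x' /esym/coset_eqP xx'.
case: piP => y' /esym/coset_eqP yy'.
apply/coset_eqP; have -> :
    (x' * y')^-1 * (x * y) = (x'^-1 * x) ^ y' * (y'^-1 * y).
  by rewrite /conjg invgM !mulgA mulgK.
by apply: gpredM => //; exact: conjg_closed.
Qed.
Lemma quotient_invE (x : G) : quotient_inv (\pi x) = \pi x^-1.
Proof.
rewrite /quotient_inv; case: piP => x' /coset_eqP xx'.
apply/coset_eqP; rewrite invgK.
have -> : x' * x^-1 = (x^-1 * x') ^ x^-1 by rewrite /conjg invgK !mulgA mulgV mul1g.
exact: conjg_closed.
Qed.

Lemma quotient_mulA : associative quotient_mul.
Proof.
by elim/quotW=> x; elim/quotW=> y; elim/quotW=> z; rewrite !quotient_mulE mulgA.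
Qed.
Lemma quotient_mul1g : left_id quotient_one quotient_mul.
Proof. by elim/quotW=> x; rewrite quotient_mulE mul1g. Qed.
Lemma quotient_mulg1 : right_id quotient_one quotient_mul.
Proof. by elim/quotW=> x; rewrite quotient_mulE mulg1. Qed.
Lemma quotient_mulVg : left_inverse quotient_one quotient_inv quotient_mul.
Proof. by elim/quotW=> x; rewrite quotient_invE quotient_mulE mulVg. Qed.
Lemma quotient_mulgV : right_inverse quotient_one quotient_inv quotient_mul.
Proof. by elim/quotW=> x; rewrite quotient_invE quotient_mulE mulgV. Qed.
HB.instance Definition _ := isGroup.Build quotient_group
  quotient_mulA quotient_mul1g quotient_mulg1 quotient_mulVg quotient_mulgV.

Definition coset_map (x : G) : quotient_group := \pi x.
End QuotientGroup.

Section FreeGroup.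
Variable X : choiceType.
Local Open Scope quotient_scope.

(* The letter (x, false) stands for x and (x, true) for its inverse. *)
Definition word := seq (X * bool).

Inductive free_equiv : word -> word -> Prop :=
| free_cancel u v x b : free_equiv (u ++ [:: (x, b), (x, ~~ b) & v]) (u ++ v)
| free_refl w : free_equiv w w
| free_sym w1 w2 : free_equiv w1 w2 -> free_equiv w2 w1
| free_trans w1 w2 w3 :
    free_equiv w1 w2 -> free_equiv w2 w3 -> free_equiv w1 w3.

Definition free_rel : rel word := fun w1 w2 => `[< free_equiv w1 w2 >].

Lemma free_rel_refl : reflexive free_rel.
Proof. by move=> w; apply/asboolP; exact: free_refl. Qed.
Lemma free_rel_sym : symmetric free_rel.
Proof. by move=> w1 w2; apply/asboolP/asboolP; exact: free_sym. Qed.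
Lemma free_rel_trans : transitive free_rel.
Proof.
by move=> w2 w1 w3 /asboolP h1 /asboolP h2; apply/asboolP; exact: free_trans h2.
Qed.
Canonical free_rel_equiv :=
  EquivRel free_rel free_rel_refl free_rel_sym free_rel_trans.

Definition free_group := {eq_quot free_rel}.
HB.instance Definition _ := Choice.on free_group.
HB.instance Definition _ := EqQuotient.on free_group.

Lemma free_eqP (w1 w2 : word) :
  w1 = w2 %[mod free_group] <-> free_equiv w1 w2.
Proof.
split; first by move/(eqquotP free_group)/asboolP.
by move=> h; apply/(eqquotP free_group)/asboolP.
Qed.

Definition word_inv (w : word) : word := rev [seq (l.1, ~~ l.2) | l <- w].

Definition free_one : free_group := \pi [::].
Definition free_mul (u v : free_group) : free_group := \pi (repr u ++ repr v).
Definition free_inv (u : free_group) : free_group := \pi (word_inv (repr u)).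

Lemma free_equiv_cat (u1 u2 v1 v2 : word) :
  free_equiv u1 u2 -> free_equiv v1 v2 -> free_equiv (u1 ++ v1) (u2 ++ v2).
Proof.
move=> hu hv; apply: (@free_trans _ (u2 ++ v1)).
  elim: hu => [u v x b|w|w1 w2 _|w1 w2 w3 _ h1 _ h2].
  - by rewrite -!catA; exact: free_cancel.
  - exact: free_refl.
  - exact: free_sym.
  - exact: free_trans h1 h2.
elim: hv => [u v x b|w|w1 w2 _|w1 w2 w3 _ h1 _ h2].
- by rewrite !catA; exact: free_cancel.
- exact: free_refl.
- exact: free_sym.
- exact: free_trans h1 h2.
Qed.

Lemma free_equiv_inv (w1 w2 : word) :
  free_equiv w1 w2 -> free_equiv (word_inv w1) (word_inv w2).
Proof.
elim=> {w1 w2} [u v x b|w|w1 w2 _|w1 w2 w3 _ h1 _ h2].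
- rewrite /word_inv !map_cat /= !rev_cat !rev_cons -!cats1 -!catA /= negbK.
  exact: free_cancel.
- exact: free_refl.
- exact: free_sym.
- exact: free_trans h1 h2.
Qed.

Lemma word_invV (w : word) : free_equiv (w ++ word_inv w) [::].
Proof.
elim: w => [|[x b] w ih]; first exact: free_refl.
rewrite /word_inv /= rev_cons -cats1 /= -cat_cons catA.
apply: (@free_trans _ ([:: (x, b)] ++ [::] ++ [:: (x, ~~ b)])).
  rewrite -cat1s -2!catA; apply: free_equiv_cat; first exact: free_refl.
  by rewrite catA; apply: free_equiv_cat; [exact: ih | exact: free_refl].
exact: (@free_cancel [::] [::]).
Qed.

Lemma word_invK : involutive word_inv.
Proof.
move=> w; rewrite /word_inv map_rev revK -map_comp -[RHS]map_id.
by apply: eq_map => -[x b] /=; rewrite negbK.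
Qed.

Lemma free_mulE (u v : word) : free_mul (\pi u) (\pi v) = \pi (u ++ v).
Proof.
rewrite /free_mul; case: piP => u' /esym/free_eqP uu'.
case: piP => v' /esym/free_eqP vv'.
by apply/free_eqP; exact: free_equiv_cat.
Qed.
Lemma free_invE (u : word) : free_inv (\pi u) = \pi (word_inv u).
Proof.
rewrite /free_inv; case: piP => u' /esym/free_eqP uu'.
by apply/free_eqP; exact: free_equiv_inv.
Qed.

Lemma free_mulA : associative free_mul.
Proof.
by elim/quotW=> x; elim/quotW=> y; elim/quotW=> z; rewrite !free_mulE catA.
Qed.
Lemma free_mul1g : left_id free_one free_mul.
Proof. by elim/quotW=> x; rewrite free_mulE. Qed.
Lemma free_mulg1 : right_id free_one free_mul.
Proof. by elim/quotW=> x; rewrite free_mulE cats0. Qed.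
Lemma free_mulgV : right_inverse free_one free_inv free_mul.
Proof.
by elim/quotW=> x; rewrite free_invE free_mulE; apply/free_eqP; exact: word_invV.
Qed.
Lemma free_mulVg : left_inverse free_one free_inv free_mul.
Proof.
elim/quotW=> x; rewrite free_invE free_mulE; apply/free_eqP.
by rewrite -{2}(word_invK x); exact: word_invV.
Qed.
HB.instance Definition _ := isGroup.Build free_group
  free_mulA free_mul1g free_mulg1 free_mulVg free_mulgV.

Definition free_gen (x : X) : free_group := \pi [:: (x, false)].
End FreeGroup.

Definition presented_group (X : choiceType) (R : set (free_group X)) : groupType :=
  quotient_group (NormalSubgroup.clone _ (normal_closure R) _).

Variant BS_gen := BS_t | BS_a.
HB.instance Definition _ := gen_eqMixin BS_gen.
HB.instance Definition _ := gen_choiceMixin BS_gen.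

(* MathComp's [~ x, y] is x^-1 * y^-1 * x * y. *)
Definition BS_relator (m n : int) : free_group BS_gen :=
  let t := free_gen BS_t in let a := free_gen BS_a in
  expgz a (n - m)%R * [~ t, expgz a m].

Definition BS (m n : int) : groupType := presented_group [set BS_relator m n].

Section LowerCentral.
Variable G : groupType.

(* Indexed from 1; the term of index 0 is a dummy, equal to that of index 1. *)
Fixpoint lower_central (c : nat) : {pred G} :=
  match c with
  | 0 => predT
  | c'.+1 => match c' with
    | 0 => predT
    | _.+1 => generated [set [~ x, y] | x in [set` lower_central c'] & y in setT]
    end
  end.

Lemma lower_central1 (c : nat) : 1 \in lower_central c.
Proof. by case: c => [|[|c]] //; exact: gpred1. Qed.
Lemma lower_centralM (c : nat) : mulg_closed (lower_central c).
Proof. by case: c => [|[|c]] //; exact: gpredM. Qed.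
Lemma lower_centralV (c : nat) : invg_closed (lower_central c).
Proof. by case: c => [|[|c]] //; exact: gpredVr. Qed.

Lemma lower_centralJ (c : nat) (x y : G) :
  x \in lower_central c -> x ^ y \in lower_central c.
Proof.
elim: c x => [|[|c] ih] // x /asboolP hx; apply/asboolP => H sAH.
pose H' : {pred G} := [pred z | z ^ y \in H].
have H'1 : 1 \in H' by rewrite inE /= conj1g gpred1.
have H'M : mulg_closed H'.
  by move=> u v; rewrite !inE /= conjMg; exact: gpredM.
have H'V : invg_closed H' by move=> u; rewrite !inE /= conjVg gpredV.
pose H1 := isMul1Closed.Build G H' H'1.
pose HM := isMulClosed.Build G H' H'M.
pose HV := isInvClosed.Build G H' H'V.
pose K : groupClosed G := HB.pack H' H1 HM HV.
apply: (hx K) => z; rewrite inE => -[u hu [v _ <-]].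
rewrite inE /= conjRg; apply: sAH; rewrite inE.
by exists (u ^ y); [exact: ih | exists (v ^ y)].
Qed.

HB.instance Definition _ c :=
  isMulClosed.Build G (lower_central c) (@lower_centralM c).
HB.instance Definition _ c :=
  isMul1Closed.Build G (lower_central c) (@lower_central1 c).
HB.instance Definition _ c :=
  isInvClosed.Build G (lower_central c) (@lower_centralV c).
HB.instance Definition _ c :=
  isConjClosed.Build G (lower_central c) (@lower_centralJ c).

Lemma lower_centralS (c : nat) : {subset lower_central c.+1 <= lower_central c}.
Proof.
case: c => [|c] // x /asboolP; apply => z; rewrite inE => -[u hu [v _ <-]].
by rewrite /commg gpredM ?gpredV ?lower_centralJ.
Qed.
End LowerCentral.
Arguments lower_central : clear implicits.

Section RelativeQuotient.
Variables (G : groupType) (H : groupClosed G) (N : normalSubgroup G).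

Definition relative_sub : {pred subgroup_type H} := [pred x | val x \in N].

Lemma relative_sub1 : 1 \in relative_sub.
Proof. by rewrite inE; exact: (@gpred1 _ N). Qed.
Lemma relative_subM : mulg_closed relative_sub.
Proof. by move=> x y; rewrite !inE; exact: (@gpredM _ N (val x) (val y)). Qed.
Lemma relative_subV : invg_closed relative_sub.
Proof. by move=> x; rewrite !inE; exact: (@gpredVr _ N (val x)). Qed.
Lemma relative_subJ (x y : subgroup_type H) :
  x \in relative_sub -> x ^ y \in relative_sub.
Proof. by rewrite !inE; exact: (@conjg_closed _ N (val x) (val y)). Qed.
HB.instance Definition _ :=
  isMulClosed.Build (subgroup_type H) relative_sub relative_subM.
HB.instance Definition _ :=
  isMul1Closed.Build (subgroup_type H) relative_sub relative_sub1.
HB.instance Definition _ :=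
  isInvClosed.Build (subgroup_type H) relative_sub relative_subV.
HB.instance Definition _ :=
  isConjClosed.Build (subgroup_type H) relative_sub relative_subJ.

(* This is H / (H :&: N), hence H / N when N is contained in H. *)
Definition relative_quotient : groupType :=
  quotient_group (NormalSubgroup.clone _ relative_sub _).
End RelativeQuotient.

(* The denominator is contained in the numerator by [lower_centralS]. *)
Definition gr (G : groupType) (c : nat) : groupType :=
  relative_quotient (GroupClosed.clone G (lower_central G c) _)
    (NormalSubgroup.clone G (lower_central G c.+1) _).

Definition is_finite_abelian (Q : groupType) : Prop :=
  finite_set [set: Q] /\ forall x y : Q, commute x y.

(* Main.v *)
Require Import Defs.
From mathcomp Require Import ssreflect ssrfun ssrbool eqtype ssrnat monoid.
From mathcomp Require Import ssralg ssrint.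
From HB Require Import structures.
From mathcomp Require Import seq choice fintype finfun bigop div generic_quotient.
From mathcomp Require Import boolp classical_sets cardinality.

(** Write [gamma_c] for the [c]-th term of the lower central series of a group
    [G].

    In [G = BS(m, n)] the relation says that [a ^ (n - m)] is the commutator of [a ^ m] and [t].
    If [n <> m], put [k = |n - m|]: then [a ^ k] lies in [gamma_2], so its
    commutator with [t] lies in [gamma_3]. If [n = m], put [k = |m|]: then
    [a ^ k] commutes with [t]. In both cases [k > 0] and the commutator of
    [a ^ k] and [t] lies in [gamma_3]. Now the commutator of [x] in [gamma_c]
    and [y] in [G] lies in [gamma_(c+1)], so it is central modulo
    [gamma_(c+2)] and therefore bimultiplicative there ([lc_map_commMg], [lc_map_commgM]). Hence
    [gamma_2 / gamma_3] is generated by the class [w] of the commutator of [a]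
    and [t], and [w ^ k = 1], so that it is a finite cyclic group
    ([finite_gr2]).

    Finiteness then propagates up the series of any finitely generated group
    ([finite_grS]). For generators [s_1, ..., s_r], bimultiplicativity shows
    that every element of [gamma_(c+1) / gamma_(c+2)] is a product of classes of
    commutators of some [u_i] in [gamma_c] with [s_i], one for each [i]. The
    class of such a commutator depends only on [u_i] modulo [gamma_(c+1)], so
    if [gamma_c / gamma_(c+1)] is finite, only finitely many products arise. *)

Set Implicit Arguments.
Unset Strict Implicit.
Unset Printing Implicit Defensive.

Local Open Scope classical_set_scope.
Local Open Scope group_scope.

(** * Generated subgroups and quotient maps *)

Lemma generated_ind (G : groupType) (A : set G) (P : G -> Prop) :
    P 1 -> (forall x y, P x -> P y -> P (x * y)) ->
    (forall x, P x -> P x^-1) -> (forall x, A x -> P x) ->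
  forall x, x \in generated A -> P x.
Proof.
move=> P1 PM PV PA x /asboolP hx.
pose H : {pred G} := [pred z | `[< P z >]].
have H1 : 1 \in H by apply/asboolP.
have HM : mulg_closed H.
  by move=> u v /asboolP Pu /asboolP Pv; apply/asboolP; exact: PM.
have HV : invg_closed H by move=> u /asboolP Pu; apply/asboolP; exact: PV.
pose K1 := isMul1Closed.Build G H H1.
pose KM := isMulClosed.Build G H HM.
pose KV := isInvClosed.Build G H HV.
pose K : groupClosed G := HB.pack H K1 KM KV.
by apply/asboolP; apply: (hx K) => z; rewrite inE => Az; apply/asboolP/PA.
Qed.

Lemma mem_generated (G : groupType) (A : set G) (x : G) :
  A x -> x \in generated A.
Proof. by move=> Ax; apply/asboolP => H sAH; apply: sAH; rewrite inE. Qed.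

Lemma coset_mapF (G : groupType) (N : normalSubgroup G) :
  {morph coset_map N : x y / x / y}.
Proof.
by move=> x y; apply/esym/(etrans _ (quotient_mulE _ _ _))/congr1/quotient_invE.
Qed.

HB.instance Definition _ (G : groupType) (N : normalSubgroup G) :=
  isGroupMorphism.Build G (quotient_group N) (coset_map N) (@coset_mapF G N).

Lemma coset_map_eqP (G : groupType) (N : normalSubgroup G) (x y : G) :
  reflect (coset_map N x = coset_map N y) (x^-1 * y \in N).
Proof. exact: coset_eqP. Qed.

Lemma coset_map_eq1P (G : groupType) (N : normalSubgroup G) (x : G) :
  reflect (coset_map N x = 1) (x \in N).
Proof.
have <- : coset_map N 1 = 1 by exact: gmulf1.
apply: (iffP idP) => [xN|/esym/coset_map_eqP].
  by apply/esym/coset_map_eqP; rewrite invg1 mul1g.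
by rewrite invg1 mul1g.
Qed.

Lemma coset_map_surj (G : groupType) (N : normalSubgroup G)
  (z : quotient_group N) : exists x, coset_map N x = z.
Proof. by elim/quotW: z => x; exists x. Qed.

Lemma commMg_central (G : groupType) (x y z : G) :
    (forall w, commute [~ x, z] w) ->
  [~ x * y, z] = [~ x, z] * [~ y, z].
Proof.
move=> xz_central; have -> : [~ x * y, z] = [~ x, z] ^ y * [~ y, z].
  by rewrite /commg /conjg !invgM !mulgA !mulgK.
by congr (_ * _); apply/conjg_fixP/commgP.
Qed.

Lemma commgM_central (G : groupType) (x y z : G) :
    (forall w, commute [~ x, y] w) ->
  [~ x, y * z] = [~ x, y] * [~ x, z].
Proof.
move=> xy_central; have -> : [~ x, y * z] = [~ x, z] * [~ x, y] ^ z.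
  by rewrite /commg /conjg !invgM !mulgA !mulgK.
by rewrite xy_central; congr (_ * _); apply/conjg_fixP/commgP.
Qed.

(** * Commutators along the lower central series *)

Local Notation lc_map G c := (coset_map (lower_central G c)).

Lemma mem_commg_lower_central (G : groupType) (c : nat) (x y : G) :
  x \in lower_central G c -> [~ x, y] \in lower_central G c.+1.
Proof.
by case: c => [|c] // xc; apply: mem_generated; exists x => //=; exists y.
Qed.

Lemma lc_map_commute (G : groupType) (c : nat) (x : G)
    (z : quotient_group (lower_central G c.+1)) :
  x \in lower_central G c -> commute (lc_map G c.+1 x) z.
Proof.
have [y <-] := coset_map_surj z => xc.
by apply/commgP/eqP; rewrite -gmulfR; apply/coset_map_eq1P/mem_commg_lower_central.
Qed.

Lemma lc_map_commMg (G : groupType) (c : nat) (x y z : G) :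
    x \in lower_central G c ->
  lc_map G c.+2 [~ x * y, z] = lc_map G c.+2 [~ x, z] * lc_map G c.+2 [~ y, z].
Proof.
move=> xc; rewrite !gmulfR gmulfM commMg_central // => w; rewrite -gmulfR.
exact/lc_map_commute/mem_commg_lower_central.
Qed.

Lemma lc_map_commgM (G : groupType) (c : nat) (x y z : G) :
    x \in lower_central G c ->
  lc_map G c.+2 [~ x, y * z] = lc_map G c.+2 [~ x, y] * lc_map G c.+2 [~ x, z].
Proof.
move=> xc; rewrite !gmulfR gmulfM commgM_central // => w; rewrite -gmulfR.
exact/lc_map_commute/mem_commg_lower_central.
Qed.

Lemma lc_map_commVg (G : groupType) (c : nat) (x y : G) :
    x \in lower_central G c ->
  lc_map G c.+2 [~ x^-1, y] = (lc_map G c.+2 [~ x, y])^-1.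
Proof.
move=> xc; apply: (mulgI (lc_map G c.+2 [~ x, y])).
by rewrite -lc_map_commMg // !mulgV comm1g gmulf1.
Qed.

Lemma lc_map_commgV (G : groupType) (c : nat) (x y : G) :
    x \in lower_central G c ->
  lc_map G c.+2 [~ x, y^-1] = (lc_map G c.+2 [~ x, y])^-1.
Proof.
move=> xc; apply: (mulgI (lc_map G c.+2 [~ x, y])).
by rewrite -lc_map_commgM // !mulgV commg1 gmulf1.
Qed.

Lemma lc_map_commXg (G : groupType) (c : nat) (x y : G) (k : nat) :
    x \in lower_central G c ->
  lc_map G c.+2 [~ x ^+ k, y] = lc_map G c.+2 [~ x, y] ^+ k.
Proof.
move=> xc; elim: k => [|k ih]; first by rewrite !expg0 comm1g gmulf1.
by rewrite !expgS lc_map_commMg // ih.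
Qed.

(** Writing [x' = x * h] with [h] in [gamma_(c+1)], the factor contributed by
    [h] is a commutator in [gamma_(c+2)]. *)
Lemma lc_map_commg_eq (G : groupType) (c : nat) (x x' y : G) :
    x \in lower_central G c -> lc_map G c.+1 x = lc_map G c.+1 x' ->
  lc_map G c.+2 [~ x, y] = lc_map G c.+2 [~ x', y].
Proof.
move=> xc /coset_map_eqP xx'; rewrite -(mulVKg x x') lc_map_commMg //.
have /coset_map_eq1P -> : [~ x^-1 * x', y] \in lower_central G c.+2.
  exact: mem_commg_lower_central.
by rewrite mulg1.
Qed.

(** By [lc_map_commgM] the commutator with a fixed [x] in [gamma_c] is a morphism
    in its second argument modulo [gamma_(c+2)], so it is enough to look at
    generators. *)
Lemma lc_map_commg_generated (G : groupType) (A : set G) (c : nat)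
    (H : groupClosed (quotient_group (lower_central G c.+2))) (x : G) :
    (forall y, y \in generated A) -> x \in lower_central G c ->
    (forall s, A s -> lc_map G c.+2 [~ x, s] \in H) ->
  forall y, lc_map G c.+2 [~ x, y] \in H.
Proof.
move=> genA xc HA y.
elim/generated_ind: y / (genA y) => [|y z Hy Hz|y Hy|//].
- by rewrite commg1 gmulf1 gpred1.
- by rewrite lc_map_commgM // gpredM.
- by rewrite lc_map_commgV // gpredV.
Qed.

(** This is the generation of [gamma_(c+2) / gamma_(c+3)] by the classes of
    commutators of elements of [gamma_(c+1)] with generators of [G]. With [H]
    arbitrary it applies to the cyclic group of [finite_gr2] as well as to the
    subgroup generated by all these classes. The indices are shifted because
    [gamma_1] does not consist of products of commutators. *)
Lemma lc_map_lower_centralS_generated (G : groupType) (A : set G) (c : nat)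
    (H : groupClosed (quotient_group (lower_central G c.+3))) :
    (forall y, y \in generated A) ->
    (forall x s, x \in lower_central G c.+1 -> A s ->
      lc_map G c.+3 [~ x, s] \in H) ->
  forall x, x \in lower_central G c.+2 -> lc_map G c.+3 x \in H.
Proof.
move=> genA HA x xc.
elim/generated_ind: x / xc => [|x y Hx Hy|x Hx|_ /= [x xc [y _ <-]]].
- by rewrite gmulf1 gpred1.
- by rewrite gmulfM gpredM.
- by rewrite gmulfV gpredV.
- by apply: (@lc_map_commg_generated _ A c.+1 H) => // s; exact: HA.
Qed.

(** * Finiteness of the graded pieces *)

(** The list [r] ranges over representatives in [G] itself: statements about
    cosets of [gamma_(c+1)] in [gamma_c] can then be carried out in the
    quotients of [G], without the type of elements of [gamma_c]. *)
Lemma finite_grP (G : groupType) (c : nat) :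
  finite_set [set: gr G c] <->
  exists r : seq G, forall x, x \in lower_central G c ->
    exists2 y, y \in r & lc_map G c.+1 x = lc_map G c.+1 y.
Proof.
split=> [/finite_seqP[r grE]|[r rP]].
  exists [seq val (repr z) | z <- r] => x xc.
  pose z : gr G c := coset_map _ (Sub x xc).
  exists (val (repr z)).
    by apply: map_f; have : [set: gr G c]%classic z by []; rewrite grE.
  apply/coset_map_eqP.
  have /coset_eqP : z = (\pi_(gr G c) (repr z))%qT by rewrite reprK.
  by rewrite inE /=.
pose f x : gr G c := coset_map _ (insubd 1 x).
apply: (@sub_finite_set _ _ (f @` [set` r])); last exact/finite_image/finite_seq.
elim/quotW=> -[x xc] _; have [y yr /coset_map_eqP xy] := rP x xc.
have yc : y \in lower_central G c.
  by rewrite -(mulVKg x y) gpredM //; exact: lower_centralS.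
exists y => //; apply/esym/coset_map_eqP.
by rewrite inE /= /insubd insubT.
Qed.

(** The ordered products over the generators [s i] of commutators of [s i] with
    elements of [gamma_(c+1)] form a subgroup modulo [gamma_(c+3)], since the
    factors are central there and multiplicative in the first argument. By
    [lc_map_lower_centralS_generated] this subgroup contains [gamma_(c+2)], and by [lc_map_commg_eq] its elements are determined
    by finitely many choices of representatives in [gr G c.+1]. *)
Lemma finite_grS (G : groupType) (I : finType) (s : I -> G) (c : nat) :
    (forall x, x \in generated (range s)) ->
  finite_set [set: gr G c.+1] -> finite_set [set: gr G c.+2].
Proof.
move=> gen /finite_grP[r rP]; apply/finite_grP.
pose f (k : {ffun I -> 'I_(size r)}) := \prod_i [~ nth 1 r (k i), s i].
exists [seq f k | k : {ffun I -> 'I_(size r)}] => x xc.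
(* Central factors can be collected generator by generator. *)
have [u uc ->] : exists2 u : I -> G, forall i, u i \in lower_central G c.+1 &
    lc_map G c.+3 x = \prod_i lc_map G c.+3 [~ u i, s i].
  pose A := [set q | exists x i,
    x \in lower_central G c.+1 /\ q = lc_map G c.+3 [~ x, s i]].
  have : lc_map G c.+3 x \in generated A.
    apply: (lc_map_lower_centralS_generated gen) xc => y _ yc [i _ <-].
    by apply: mem_generated; exists y, i.
  elim/generated_ind=> [|q q' [u uc ->] [v vc ->]|q [u uc ->]|_ [y [i [yc ->]]]].
  - exists (fun=> 1) => [i|]; first exact: gpred1.
    by rewrite big1 // => i _; rewrite comm1g gmulf1.
  - exists (fun i => u i * v i) => [i|]; first exact: gpredM.
    rewrite -prodgM_commute => [|i j _ _].
      by apply: eq_bigr => i _; rewrite lc_map_commMg.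
    exact/lc_map_commute/mem_commg_lower_central.
  - exists (fun i => (u i)^-1) => [i|]; first by rewrite gpredV.
    apply: (mulgI (\prod_i lc_map G c.+3 [~ u i, s i])).
    rewrite mulgV -prodgM_commute => [|i j _ _].
      by rewrite big1 // => i _; rewrite lc_map_commVg ?mulgV.
    exact/lc_map_commute/mem_commg_lower_central.
  - exists (fun j => if j == i then y else 1) => [j|].
      by case: ifP => // _; exact: gpred1.
    transitivity (\prod_(j | j == i) lc_map G c.+3 [~ y, s j]).
      by rewrite big_pred1_eq.
    rewrite big_mkcond.
    by apply: eq_bigr => j _; case: eqP => [->//|_]; rewrite comm1g gmulf1.
have /fin_all_exists[k kP] i : exists k : 'I_(size r),
    lc_map G c.+2 (u i) = lc_map G c.+2 (nth 1 r k).
  have [y /(nthP 1)[j jr <-] ->] := rP _ (uc i).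
  by exists (Ordinal jr).
exists (f (finfun k)); first by apply: map_f; rewrite mem_enum.
rewrite gmulf_prod; apply: eq_bigr => i _.
by rewrite ffunE; apply: lc_map_commg_eq.
Qed.

(** Natural exponents suffice because the inverse of [w ^+ i] is
    [w ^+ (i * k.-1)]. *)
Lemma mem_generated_set1 (G : groupType) (w x : G) (k : nat) :
    (0 < k)%N -> w ^+ k = 1 -> x \in generated [set w] ->
  exists2 i, (i < k)%N & x = w ^+ i.
Proof.
move=> k0 wk xw; suff [i ->] : exists i, x = w ^+ i.
  exists (i %% k)%N; first exact: ltn_pmod.
  by rewrite [in LHS](divn_eq i k) expgnDr mulnC expgnA wk expg1n mul1g.
elim/generated_ind: x / xw => [|x y [i ->] [j ->]|x [i ->]|x ->].
- by exists 0%N.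
- by exists (i + j)%N; rewrite expgnDr.
- exists (i * k.-1)%N; apply: (mulgI (w ^+ i)).
  by rewrite mulgV -expgnDr -mulnS prednK // mulnC expgnA wk expg1n.
- by exists 1%N.
Qed.

(** Modulo [gamma_3] commutators are bimultiplicative on all of [G], so
    [gamma_2 / gamma_3] is generated by the class of [[~ a, t]]; the [k]-th power
    of that class is the class of [[~ a ^+ k, t]], which is trivial. *)
Lemma finite_gr2 (G : groupType) (a t : G) (k : nat) :
    (forall x, x \in generated [set a; t]) ->
    (0 < k)%N -> [~ a ^+ k, t] \in lower_central G 3 ->
  finite_set [set: gr G 2].
Proof.
move=> gen k0 akt; apply/finite_grP; set w := [~ a, t].
have wk : lc_map G 3 w ^+ k = 1.
  by rewrite -lc_map_commXg //; apply/coset_map_eq1P.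
have aw y : lc_map G 3 [~ a, y] \in generated [set lc_map G 3 w].
  apply: (lc_map_commg_generated gen) => // s [->|->]; last exact: mem_generated.
  by rewrite commgg gmulf1 gpred1.
have tw y : lc_map G 3 [~ t, y] \in generated [set lc_map G 3 w].
  apply: (lc_map_commg_generated gen) => // s [->|->].
    by rewrite -invgR gmulfV gpredV; exact: mem_generated.
  by rewrite commgg gmulf1 gpred1.
exists [seq w ^+ i | i <- iota 0 k] => x xc.
have : lc_map G 3 x \in generated [set lc_map G 3 w].
  apply: (lc_map_lower_centralS_generated gen) xc => y s _ As.
  by rewrite -invgR gmulfV gpredV; case: As => ->; [exact: aw | exact: tw].
case/(mem_generated_set1 k0 wk) => i ik ->; exists (w ^+ i).
  by apply: map_f; rewrite mem_iota.
by rewrite gmulfXn.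
Qed.

Lemma gr_commute (G : groupType) (c : nat) (x y : gr G c) : commute x y.
Proof.
have [u <-] := coset_map_surj x; have [v <-] := coset_map_surj y.
apply/commgP/eqP; rewrite -gmulfR; apply/coset_map_eq1P.
rewrite inE (gmulfR val u v) mem_commg_lower_central //; exact: valP.
Qed.

(** * Baumslag-Solitar groups *)

Lemma presented_group_generated (X : choiceType) (R : set (free_group X))
    (x : presented_group R) :
  x \in generated (range (fun i => coset_map (normal_closure R) (free_gen i))).
Proof.
have [y <-] := coset_map_surj x; elim/quotW: y => w.
elim: w => [|[i b] w ih].
  by have -> : (\pi_(free_group X) [::])%qT = 1 by []; rewrite gmulf1 gpred1.
have -> : (\pi_(free_group X) ((i, b) :: w))%qT =
    (if b then (free_gen i)^-1 else free_gen i) * (\pi_(free_group X) w)%qT.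
  case: b; last by rewrite [RHS]free_mulE.
  have -> : (free_gen i)^-1 = (\pi_(free_group X) [:: (i, true)])%qT.
    exact: free_invE.
  by rewrite [RHS]free_mulE.
rewrite gmulfM gpredM //; case: b; rewrite ?gmulfV ?gpredV;
  by apply: mem_generated; exists i.
Qed.

Lemma expgz_commute (G : groupType) (x y : G) (k : int) :
  commute (expgz x k) y -> commute (x ^+ absz k) y.
Proof. by case: k => // k /commute_sym/commuteV; rewrite invgK => /commute_sym. Qed.

Lemma expgz_mem (G : groupType) (H : groupClosed G) (x : G) (k : int) :
  (expgz x k \in H) = (x ^+ absz k \in H).
Proof. by case: k => // k; rewrite /= gpredV. Qed.

Lemma gmulf_expgz (G H : groupType) (f : UMagmaMorphism.type G H) (x : G)
  (k : int) : f (expgz x k) = expgz (f x) k.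
Proof. by case: k => k /=; rewrite ?gmulfV gmulfXn. Qed.

Theorem corollary3 (m n : int) (c : nat)
    (hm : m <> 0%R) (hn : n <> 0%R) (hc : (2 <= c)%N) :
  is_finite_abelian (gr (BS m n) c).
Proof.
split; last exact: gr_commute.
pose q := coset_map (normal_closure [set BS_relator m n]).
pose a : BS m n := q (free_gen BS_a); pose t : BS m n := q (free_gen BS_t).
have gen (x : BS m n) : x \in generated [set a; t].
  elim/generated_ind: x / (presented_group_generated x).
  - exact: gpred1.
  - by move=> x y; exact: gpredM.
  - by move=> x; rewrite gpredV.
  - by move=> _ [[] _ <-]; apply: mem_generated; [right | left].
have rel : expgz a (n - m)%R * [~ t, expgz a m] = 1.
  have /coset_map_eq1P :
      BS_relator m n \in normal_closure [set BS_relator m n].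
    by apply/asboolP => N; apply; rewrite inE.
  by rewrite gmulfM gmulfR !gmulf_expgz.
(* If [n = m] the relator is a commutator of [t] with a power of [a]; otherwise
   it puts a power of [a] into [gamma_2]. *)
have [k k0 akt] : exists2 k, (0 < k)%N & [~ a ^+ k, t] \in lower_central _ 3.
  have [nm|nm] := eqVneq n m.
    exists (absz m); first by rewrite absz_gt0; apply/eqP.
    move: rel; have -> : (n - m)%R = 0%R by rewrite nm GRing.subrr.
    rewrite mul1g => /eqP; rewrite commg1_sym => /commgP.
    by move=> /expgz_commute/commgP/eqP ->; exact: gpred1.
  exists (absz (n - m)%R); first by rewrite absz_gt0 GRing.subr_eq0.
  apply: mem_commg_lower_central; rewrite -expgz_mem.
  have -> : expgz a (n - m)%R = [~ expgz a m, t].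
    by apply/eqP; rewrite -invgR -mulg_eq1 rel.
  exact: mem_commg_lower_central.
case: c hc => [|[|c]] // _.
elim: c => [|c ih]; first exact: (finite_gr2 gen k0 akt).
apply: (@finite_grS _ bool (fun b => if b then a else t)) ih => x.
suff -> : range (fun b : bool => if b then a else t) = [set a; t] by [].
apply/seteqP; split=> [_ [[] _ <-]|_ [->|->]]; [by left | by right | |].
  by exists true.
by exists false.
Qed.
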